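(* Let $\Gamma$ and $\Lambda$ be rectangular lattices (a priori in Euclidean spaces $\mathbb{R}^n$ and $\mathbb{R}^m$ respectively). If the rectangular flat tori $\mathbb{R}^n/\Gamma$ and $\mathbb{R}^m/\Lambda$ are isospectral, then they are isometric.
   Context: A full-rank lattice in $\mathbb{R}^n$ is a set $\Gamma=A\mathbb{Z}^n$ with $A$ an invertible real $n\times n$ matrix, called a basis matrix of $\Gamma$. Its flat torus is $\mathbb{R}^n/\Gamma$ with the Riemannian metric induced by the Euclidean metric. A rectangular lattice is a (full-rank) lattice that has a diagonal basis matrix; its flat torus is called a rectangular flat torus. Two flat tori are isospectral if their Laplace operators ($\Delta=-\sum_i\partial^2/\partial x_i^2$) have the same eigenvalues counted with multiplicity. Equivalently, the multisets of lengths $\{\|\gamma\|:\gamma\in\Gamma\}$ and $\{\|\lambda\|:\lambda\in\Lambda\}$, counted with multiplicity, coincide. Two flat tori are isometric if they are isometric as Riemannian manifolds; equivalently, they have the same dimension $n$ and $\Lambda=C\Gamma$ for some orthogonal matrix $C\in \mathrm{O}_n(\mathbb{R})$. *)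

(* Defs.v *)
From HB Require Import structures.
From mathcomp Require Import all_boot all_order all_algebra generic_quotient.
From mathcomp Require Import all_classical all_reals all_analysis.
Import Order.TTheory GRing.Theory Num.Theory.
Import numFieldNormedType.Exports.
Set Implicit Arguments.
Unset Strict Implicit.
Unset Printing Implicit Defensive.
Local Open Scope classical_set_scope.
Local Open Scope ring_scope.
Local Open Scope quotient_scope.

Definition int_span (R : realType) (n : nat) (A : 'M[R]_n) : set 'cV[R]_n :=
  [set A *m map_mx intr z | z in [set: 'cV[int]_n]].

Definition basis_matrix (R : realType) (n : nat) (G : set 'cV[R]_n)
    (A : 'M[R]_n) : Prop :=
  A \in unitmx /\ G = int_span A.

Record lattice (R : realType) (n : nat) := Lattice {
  lattice_set :> set 'cV[R]_n;
  lattice_basis : exists A, basis_matrix lattice_set A }.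

Definition rectangular (R : realType) (n : nat) (G : lattice R n) : Prop :=
  exists2 A, basis_matrix G A & is_diag_mx A.

Section Torus.
Context (R : realType) (n : nat) (G : lattice R n).

Definition lattice_rel (x y : 'cV[R]_n) : bool := `[< lattice_set G (x - y) >].

Lemma lattice_set0 : lattice_set G 0.
Proof.
have [A [_ ->]] := lattice_basis G.
by exists 0 => //; rewrite map_mx0 mulmx0.
Qed.

Lemma lattice_setB x y :
  lattice_set G x -> lattice_set G y -> lattice_set G (x - y).
Proof.
have [A [_ ->]] := lattice_basis G => -[z _ <-] [w _ <-].
by exists (z - w) => //; rewrite map_mxB mulmxBr.
Qed.

Lemma lattice_rel_refl : reflexive lattice_rel.
Proof. by move=> x; apply/asboolP; rewrite subrr; exact: lattice_set0. Qed.

Lemma lattice_rel_sym : symmetric lattice_rel.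
Proof.
have h x y : lattice_rel x y -> lattice_rel y x.
  move=> /asboolP xy; apply/asboolP.
  by rewrite -opprB -sub0r; apply: lattice_setB => //; exact: lattice_set0.
by move=> x y; apply/idP/idP; exact: h.
Qed.

Lemma lattice_rel_trans : transitive lattice_rel.
Proof.
move=> y x z /asboolP xy /asboolP yz; apply/asboolP.
have /asboolP zy : lattice_rel z y by rewrite lattice_rel_sym; apply/asboolP.
have -> : x - z = (x - y) - (z - y) by rewrite opprB addrA subrK.
exact: lattice_setB.
Qed.

Canonical lattice_equiv_rel :=
  EquivRel lattice_rel lattice_rel_refl lattice_rel_sym lattice_rel_trans.

Definition torus : Type := {eq_quot lattice_rel}.

Definition torus_pi (x : 'cV[R]_n) : torus := \pi_{eq_quot lattice_rel} x.

End Torus.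

Definition basis_vec (R : realType) (n : nat) (i : 'I_n) : 'cV[R]_n :=
  delta_mx i 0.
Arguments basis_vec {R n} i.

(* [U] is meant to be open: then the partial derivatives at the points of [U]
   depend only on the restriction of [f] to [U]. *)
Fixpoint Ck_on (R : realType) (n : nat) (U : set 'cV[R]_n) (k : nat)
    (f : 'cV[R]_n -> R) : Prop :=
  (forall x, U x -> {for x, continuous f}) /\
  if k is k'.+1 then
    forall i : 'I_n,
      (forall x, U x -> derivable f x (basis_vec i)) /\
      Ck_on U k' ('D_(basis_vec i) f)
  else True.

Definition smooth_on (R : realType) (n : nat) (U : set 'cV[R]_n)
    (f : 'cV[R]_n -> R) : Prop :=
  forall k, Ck_on U k f.

Definition laplacian (R : realType) (n : nat) (f : 'cV[R]_n -> R)
    (x : 'cV[R]_n) : R :=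
  - \sum_(i < n) 'D_(basis_vec i) ('D_(basis_vec i) f) x.

(* A function on the torus is smooth, and its Laplacian is computed, through
   its periodic lift to R^n: the projection is a local isometry. *)
Definition laplace_eigenspace (R : realType) (n : nat) (G : lattice R n)
    (mu : R) : set (torus G -> R) :=
  [set f : torus G -> R | smooth_on setT (f \o torus_pi G) /\
    forall x, laplacian (f \o torus_pi G) x = mu * f (torus_pi G x)].
Arguments laplace_eigenspace {R n} G mu.

Definition has_dim (R : realType) (T : Type) (V : set (T -> R)) (d : nat) :
    Prop :=
  exists b : 'I_d -> T -> R,
    [/\ forall i, V (b i),
        forall c : 'I_d -> R,
          (forall t, \sum_(i < d) c i * b i t = 0) -> forall i, c i = 0 &
        forall f, V f ->
          exists c : 'I_d -> R, forall t, f t = \sum_(i < d) c i * b i t].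

(* Eigenspaces of the Laplacian on a flat torus are finite-dimensional, and
   [mu] is not an eigenvalue exactly when its eigenspace has dimension 0; so
   this says that the eigenvalues and their multiplicities coincide. *)
Definition isospectral (R : realType) (n m : nat) (G : lattice R n)
    (L : lattice R m) : Prop :=
  forall (mu : R) (d : nat),
    has_dim (laplace_eigenspace G mu) d <-> has_dim (laplace_eigenspace L mu) d.

(* The norm of the library on 'cV[R]_n is the sup norm, hence not Euclidean. *)
Definition dot (R : realType) (n : nat) (u v : 'cV[R]_n) : R :=
  \sum_(i < n) u i 0 * v i 0.

Section Maps.
Context (R : realType) (n m : nat) (G : lattice R n) (L : lattice R m).

(* [F] expresses [phi] on the image of [U] in the local coordinates provided
   by the two projections. *)
Definition local_lift (phi : torus G -> torus L) (U : set 'cV[R]_n)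
    (F : 'cV[R]_n -> 'cV[R]_m) : Prop :=
  [/\ open U,
      forall j, smooth_on U (fun x => F x j 0) &
      forall x, U x -> torus_pi L (F x) = phi (torus_pi G x)].

Definition smooth_map (phi : torus G -> torus L) : Prop :=
  forall x, exists U, exists2 F, local_lift phi U F & U x.

Definition preserves_metric (phi : torus G -> torus L) : Prop :=
  forall x, exists U F, [/\ local_lift phi U F, U x &
    forall u v, dot ('d F x u) ('d F x v) = dot u v].

End Maps.

Definition isometric (R : realType) (n m : nat) (G : lattice R n)
    (L : lattice R m) : Prop :=
  exists (phi : torus G -> torus L) (psi : torus L -> torus G),
    [/\ cancel phi psi, cancel psi phi, smooth_map phi, smooth_map psi &
        preserves_metric phi].

(* Main.v *)
Require Import Defs.
From HB Require Import structures.
From mathcomp Require Import all_boot all_order all_algebra generic_quotient.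
From mathcomp Require Import perm.
From mathcomp Require Import all_classical all_reals all_analysis.
From mathcomp Require Import lra ring zify.
Import Order.TTheory GRing.Theory Num.Theory.
Import numFieldNormedType.Exports.
Set Implicit Arguments.
Unset Strict Implicit.
Unset Printing Implicit Defensive.
Local Open Scope classical_set_scope.
Local Open Scope ring_scope.

(** After changing signs, a rectangular lattice is the set of vectors
    [(a_1 z_1, ..., a_n z_n)] with [z] integral and all [a_i > 0].  For [k] in
    [Z^n] put [w_i = 2 pi k_i / a_i].  The Hartley function
    [x |-> cos <w, x> + sin <w, x>] is a real eigenfunction of the torus with
    eigenvalue [sum_i (2 pi / a_i)^2 k_i^2], and there is exactly one for each
    [k].  These functions are a complete orthonormal system, so the
    multiplicity of [mu] is the number of ways in which the diagonal quadratic
    form with coefficients [(2 pi / a_i)^2] represents [mu]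
    ([eigenspace_nsols]).  It remains to see that these representation numbers
    determine the coefficients up to order ([nsols_inj]); a reordering of the
    [a_i] is realized by a permutation of the coordinates, which is an isometry
    of the tori ([isometric_perm]).

    Recovering the coefficients: the smallest positive number that is
    represented is the smallest coefficient [x].  The numbers for the form
    without [x] are then found by recursion on [mu], because the
    representations of [mu] by the full form in which the variable of [x]
    vanishes are the difference between all of them and those that use the
    values at [mu - x k^2] with [k <> 0].  Hence two forms with the same
    representation numbers share their smallest coefficient, and it can be
    split off.

    Completeness: the integral over the torus only has to be a functional that
    is linear, monotone and strictly positive, and that kills partial
    derivatives.  The averages over the finite grids of mesh [a_i / 2^p] have
    these properties in the limit: they are invariant under the translations
    of the grid, so a difference quotient with step [a_i / 2^p] has average
    exactly 0.  A limit along an ultrafilter on [nat] exists for free, by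
    compactness; this is [mean].  Integration by parts then shows that an
    eigenfunction is orthogonal to every Hartley function with another
    eigenvalue ([mean_eigenfunction]).  What is left after subtracting the
    projection on the finitely many others is a continuous function
    orthogonal to all Hartley functions, and it vanishes by a kernel argument
    ([hartley_null_le0]): it is also orthogonal to the powers of a
    trigonometric polynomial that exceeds 1 only close to a given point, and
    those powers concentrate the mean at that point. *)

(** * Representation numbers of diagonal quadratic forms *)

Section Count.
Context {R : realType}.
Implicit Types (b c : seq R) (mu x y : R) (z : seq int).

Fixpoint qform b z : R :=
  if b is x :: b' then
    if z is k :: z' then x * k%:~R ^+ 2 + qform b' z' else 0
  else 0.

(** Locked, since simplification would peel off the first integer. *)
Definition int_range (K : nat) : seq int :=
  locked [seq j%:Z - K%:Z | j <- iota 0 K.*2.+1].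

Lemma int_range_uniq K : uniq (int_range K).
Proof.
rewrite /int_range -lock map_inj_uniq ?iota_uniq// => i j ij.
by apply/eqP; rewrite -eqz_nat; apply/eqP; apply: (addIr (- K%:Z)).
Qed.

Lemma mem_int_range K k : (k \in int_range K) = (`|k|%N <= K)%N.
Proof.
rewrite /int_range -lock; apply/mapP/idP => [[j]|kK].
  by rewrite mem_iota => jK ->; lia.
by exists (absz (k + K%:Z)); [rewrite mem_iota; lia | lia].
Qed.

Definition sq_bound x mu : nat := Num.truncn `|mu / x|.

Lemma sq_boundP x mu (k : int) :
  0 < x -> x * k%:~R ^+ 2 <= mu -> (`|k|%N <= sq_bound x mu)%N.
Proof.
move=> x0 kmu.
have kle : (`|k|%N)%:R <= mu / x.
  rewrite ler_pdivlMr// mulrC; apply: le_trans kmu.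
  by rewrite ler_pM2l// natr_absz -rmorphXn/= ler_int; nia.
have kle' : (`|k|%N)%:R <= `|mu / x| by apply: le_trans kle (ler_norm _).
by rewrite truncn_ge_nat.
Qed.

(** The first entry is bounded by [mu] because the other terms of the form are
    nonnegative. *)
Fixpoint sols b mu : seq (seq int) :=
  if b is x :: b' then
    [seq k :: z | k <- int_range (sq_bound x mu),
                  z <- sols b' (mu - x * k%:~R ^+ 2)]
  else if mu == 0 then [:: [::]] else [::].

Definition nsols b mu : nat := size (sols b mu).

Lemma qform_ge0 b z : {in b, forall x, 0 < x} -> 0 <= qform b z.
Proof.
elim: b z => [|x b IH] [|k z]//= b0; rewrite addr_ge0//.
  by rewrite mulr_ge0 ?sqr_ge0// ltW// b0 ?mem_head.
by apply: IH => y yb; rewrite b0// inE yb orbT.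
Qed.

Lemma pos_cons x b : {in x :: b, forall y : R, 0 < y} ->
  0 < x /\ {in b, forall y, 0 < y}.
Proof.
by move=> h; split=> [|y yb]; apply: h; rewrite inE ?eqxx// yb orbT.
Qed.

Lemma mem_sols b mu z : {in b, forall x, 0 < x} ->
  (z \in sols b mu) = (size z == size b) && (qform b z == mu).
Proof.
elim: b mu z => [|x b IH] mu z /=.
  by move=> _; have [_|_] := eqVneq mu 0; case: z.
move=> /pos_cons[x0 b0]; apply/idP/andP => [|].
  move=> /(@allpairsPdep int (fun=> seq int) (seq int))[k [w [kK wb ->]]].
  move: wb; rewrite IH// => /andP[/eqP sw /eqP qw] /=.
  by rewrite sw qw addrC subrK !eqxx.
case: z => [|k z] [] //= /eqP[sz] /eqP <-.
apply/(@allpairsPdep int (fun=> seq int) (seq int)); exists k, z; split=> //.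
  by rewrite mem_int_range sq_boundP// lerDl qform_ge0.
by rewrite IH// sz eqxx/= addrC addKr.
Qed.

Lemma sols_uniq b mu : uniq (sols b mu).
Proof.
elim: b mu => [|x b IH] mu /=; first by case: ifP.
apply: allpairs_uniq_dep => //; first exact: int_range_uniq.
by move=> [k z] [l w] _ _ [-> ->].
Qed.

Lemma nsols_cons x b mu :
  nsols (x :: b) mu =
  (\sum_(k <- int_range (sq_bound x mu)) nsols b (mu - x * k%:~R ^+ 2))%N.
Proof. by rewrite /nsols/= size_allpairs_dep sumnE big_map. Qed.

(** Exchanging the first two entries maps solutions to solutions. *)
Lemma nsols_swap_le x y b mu : {in x :: y :: b, forall x, 0 < x} ->
  (nsols (x :: y :: b) mu <= nsols (y :: x :: b) mu)%N.
Proof.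
move=> xyb0.
pose f (z : seq int) := if z is k :: l :: z' then l :: k :: z' else z.
rewrite /nsols -(size_map f) uniq_leq_size//.
  rewrite map_inj_uniq ?sols_uniq//.
  by apply: (can_inj (g := f)) => -[|k [|l z]].
move=> _ /mapP[z zs ->]; move: zs; rewrite !mem_sols//; last first.
  by move=> w; rewrite !inE orbCA => wb; apply: xyb0; rewrite !inE.
by case: z => [|k [|l z]]//= /andP[-> /eqP <-]; rewrite addrCA eqxx.
Qed.

Lemma nsols_swap x y b mu : {in x :: y :: b, forall x, 0 < x} ->
  nsols (x :: y :: b) mu = nsols (y :: x :: b) mu.
Proof.
move=> xyb0; apply/eqP; rewrite eqn_leq !nsols_swap_le//.
by move=> w; rewrite !inE orbCA => wb; apply: xyb0; rewrite !inE.
Qed.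

Lemma nsols_rem x b mu : {in b, forall x, 0 < x} -> x \in b ->
  nsols b mu = nsols (x :: rem x b) mu.
Proof.
elim: b mu => [//|y b IH] mu yb0 /=; have [->//|yx] := eqVneq y x.
rewrite inE eq_sym (negPf yx)/= => xb.
have [y0 b0] := pos_cons yb0.
rewrite [RHS]nsols_swap; last first.
  move=> z; rewrite !inE => /or3P[/eqP ->|/eqP ->|/mem_rem zb]//.
    exact: b0.
  exact: b0.
rewrite !nsols_cons; apply: eq_bigr => k _; exact: IH.
Qed.

(** The recursion behind the theorem: among the terms of [nsols_cons], the one
    for [k = 0] is the number wanted at [mu], and the others are values at [mu -
    x * k ^ 2 <= mu - x]. Induction on [mu] in steps of [x] starts at negative
    numbers, which are not represented. *)
Lemma nsols_cancel x b c : 0 < x -> nsols (x :: b) =1 nsols (x :: c) ->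
  {in b, forall x, 0 < x} -> {in c, forall x, 0 < x} ->
  nsols b =1 nsols c.
Proof.
move=> x0 bc b0 c0 mu.
have neg d nu : {in d, forall x, 0 < x} -> nu < 0 -> nsols d nu = 0%N.
  move=> d0 nu0; apply/eqP; rewrite size_eq0; apply/eqP.
  case E : (sols d nu) => [//|z s]; have := mem_head z s.
  rewrite -E mem_sols// => /andP[_ /eqP qz].
  by move: nu0; rewrite -qz ltNge qform_ge0.
have [p mup] : exists p : nat, mu < p%:R * x.
  exists (Num.truncn `|mu / x|).+1; rewrite -ltr_pdivrMr//.
  by apply: le_lt_trans (ler_norm _) (truncnS_gt _).
elim: p mu mup => [|p IH] mu mup; first by rewrite !neg// -(mul0r x).
have := bc mu; rewrite !nsols_cons.
have k0 : 0 \in int_range (sq_bound x mu) by rewrite mem_int_range.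
rewrite !(bigD1_seq 0)//= ?int_range_uniq// expr0n mulr0 subr0.
rewrite (eq_bigr (fun k : int => nsols c (mu - x * k%:~R ^+ 2))).
  by move=> /addIn.
move=> k kn0; apply: IH.
have : 1 <= (k%:~R : R) ^+ 2.
  by rewrite -rmorphXn/= -[1]/(1%:~R) ler_int; move: kn0; nia.
by move: mup; rewrite -natr1; nra.
Qed.

Lemma nsols_mem_gt0 b x : {in b, forall x, 0 < x} -> x \in b ->
  (0 < nsols b x)%N.
Proof.
move=> b0 xb; rewrite (nsols_rem _ b0 xb) lt0n size_eq0; apply/eqP => E.
have : (1 :: nseq (size (rem x b)) 0) \in sols (x :: rem x b) x.
  rewrite mem_sols; last first.
    by move=> y; rewrite inE => /orP[/eqP ->|/mem_rem/b0//]; exact: b0.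
  rewrite /= size_nseq eqxx/= expr1n mulr1; apply/eqP.
  suff -> : qform (rem x b) (nseq (size (rem x b)) 0) = 0 by rewrite addr0.
  by elim: (rem x b) => //= y s ->; rewrite expr0n mulr0 addr0.
by rewrite E.
Qed.

Lemma nsols_gt0_mem b mu : {in b, forall x, 0 < x} -> 0 < mu ->
  (0 < nsols b mu)%N -> exists2 x, x \in b & x <= mu.
Proof.
move=> b0 mu0; rewrite lt0n size_eq0 => ne.
case E : (sols b mu) ne => [//|z s] _; have := mem_head z s.
rewrite -E mem_sols// => /andP[_ /eqP]; clear E s.
elim: b z mu mu0 b0 => [|x b IH] [|k z] mu mu0 //=.
- by move=> _ mu0'; rewrite -mu0' ltxx in mu0.
- by move=> _ mu0'; rewrite -mu0' ltxx in mu0.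
- by move=> _ mu0'; rewrite -mu0' ltxx in mu0.
move=> /pos_cons[x0 b0]; have [->|k0] := eqVneq k 0.
  rewrite expr0n mulr0 add0r => /(IH z _ mu0 b0)[y yb ymu].
  by exists y => //; rewrite inE yb orbT.
move=> <-; exists x; first exact: mem_head.
have : 1 <= (k%:~R : R) ^+ 2.
  by rewrite -rmorphXn/= -[1]/(1%:~R) ler_int; move: k0; nia.
by have := qform_ge0 z b0; nra.
Qed.

Lemma seq_has_min b :
  b != [::] -> exists2 x, x \in b & {in b, forall y, x <= y}.
Proof.
elim: b => [//|x b IH] _; have [->|/IH[y yb ymin]] := eqVneq b [::].
  by exists x => [|y]; rewrite inE// => /eqP ->.
have [xy|yx] := leP x y.
  exists x => [|z]; rewrite ?mem_head// inE => /orP[/eqP ->//|/ymin].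
  exact: le_trans.
exists y => [|z]; rewrite inE ?yb ?orbT// => /orP[/eqP ->|/ymin//].
exact: ltW.
Qed.

(** The smallest coefficient [x] of [b] is represented by [c], so some
    coefficient [y <= x] of [c] exists; exchanging the roles gives a coefficient
    [w <= y] of [b], and minimality of [x] forces [w = y = x]. This common
    coefficient is then cancelled. *)
Theorem nsols_inj b c : {in b, forall x, 0 < x} -> {in c, forall x, 0 < x} ->
  nsols b =1 nsols c -> perm_eq b c.
Proof.
have [p] := ubnP (size b).
elim: p b c => // p IH b c bp b0 c0 bc.
have [bE|/seq_has_min[x xb xmin]] := eqVneq b [::].
  rewrite bE; case: c c0 bc => [//|y c] c0 bc.
  have := nsols_mem_gt0 c0 (mem_head y c).
  have y0 := c0 _ (mem_head y c).
  by rewrite -bc bE /nsols/= gt_eqF.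
have x0 := b0 _ xb.
have /(nsols_gt0_mem c0 x0)[y yc yx] : (0 < nsols c x)%N.
  by rewrite -bc nsols_mem_gt0.
have y0 := c0 _ yc.
have /(nsols_gt0_mem b0 y0)[w wb wy] : (0 < nsols b y)%N.
  by rewrite bc nsols_mem_gt0.
have xc : x \in c.
  by have -> : x = y by apply/le_anti; rewrite yx (le_trans (xmin _ wb)).
rewrite (perm_trans (perm_to_rem xb))// perm_sym.
rewrite (perm_trans (perm_to_rem xc))//.
have rb0 : {in rem x b, forall x, 0 < x} by move=> z /mem_rem/b0.
have rc0 : {in rem x c, forall x, 0 < x} by move=> z /mem_rem/c0.
rewrite perm_cons perm_sym; apply: IH => //.
  by rewrite size_rem//; move: bp; case: (b) xb => //.
apply: (nsols_cancel x0) => // mu.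
by rewrite -!nsols_rem.
Qed.

End Count.

(** * Derivatives along lines *)

Section Line.
Context {R : realType} {n : nat}.
Implicit Types (u : 'cV[R]_n -> R) (x v : 'cV[R]_n).

(** The difference quotients of [u] in the direction [v] are literally those of
    a function of one real variable; this gives access to the calculus on the
    line. *)
Lemma line_quotient u x v (s : R) :
  (fun h : R => h^-1 *:
    (((fun t : R => u (x + t *: v)) \o shift s) (h *: (1 : R)) -
     u (x + s *: v))) =
  (fun h : R => h^-1 *: ((u \o shift (x + s *: v)) (h *: v) - u (x + s *: v))).
Proof.
apply/funext => h /=; congr (_ *: (u _ - _)).
by rewrite [h *: _]mulr1 scalerDl addrCA.
Qed.

Lemma derivable_line u x v s :
  derivable u (x + s *: v) v <->
  derivable (fun t : R => u (x + t *: v)) s (1 : R).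
Proof. by rewrite /derivable line_quotient. Qed.

Lemma derive_line u x v s :
  'D_(1 : R) (fun t : R => u (x + t *: v)) s = 'D_v u (x + s *: v).
Proof. by rewrite /derive line_quotient. Qed.

Lemma is_derive_line u x v d :
  is_derive (0 : R) (1 : R) (fun t : R => u (x + t *: v)) d ->
  is_derive x v u d.
Proof.
move=> [du <-]; have xE : x = x + (0 : R) *: v by rewrite scale0r addr0.
split; first by rewrite xE; apply/derivable_line.
by rewrite derive_line -xE.
Qed.

Lemma MVT_line u x v (h : R) : 0 < h -> (forall y, derivable u y v) ->
  exists2 t, 0 <= t <= h & u (x + h *: v) - u x = 'D_v u (x + t *: v) * h.
Proof.
move=> h0 du; pose w (t : R) := u (x + t *: v).
have dw (t : R) : derivable w t 1 by apply/derivable_line.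
have [||t tI] := @MVT_segment R w (fun t => 'D_v u (x + t *: v)) _ _ (ltW h0).
- by move=> t _; split=> //; rewrite derive_line.
- by apply: derivable_within_continuous => t _.
rewrite /w scale0r addr0 subr0 => wE; exists t => //. 
Qed.

End Line.

(** * Continuous periodic functions and their mean *)

Section Periodic.
Context {R : realType} {n : nat} (a : 'I_n -> R).
Hypothesis a0 : forall i, 0 < a i.
Implicit Types (f g u : 'cV[R]_n -> R) (x y : 'cV[R]_n).

Definition lattice_vec (z : 'I_n -> int) : 'cV[R]_n := \col_i (a i * (z i)%:~R).

Definition lattice_periodic f := forall z x, f (x + lattice_vec z) = f x.

Definition cperiodic f := continuous f /\ lattice_periodic f.

(** A compact set that meets every orbit of the lattice: it replaces the
    compactness of the torus. *)
Definition period_cell : set 'cV[R]_n := [set x | forall i, 0 <= x i 0 <= a i].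

Lemma period_cell_compact : compact period_cell.
Proof.
pose A := [set v : 'rV[R]_n | forall i, `[0, a i]%classic (v ord0 i)].
have cA : compact A.
  apply: (@rV_compact R n (fun i => `[0, a i]%classic)) => i.
  exact: (@segment_compact R 0 (a i)).
have tc : continuous (fun v : 'rV[R]_n => v^T : 'cV[R]_n).
  move=> v B /nbhs_ballP[e e0 eB]; apply/nbhs_ballP; exists e => //= w [_ vw].
  by apply: eB; split=> // i j; rewrite !mxE; exact: vw.
have -> : period_cell = [set v^T | v in A].
  apply/seteqP; split=> [x xc|_ [v vA <-] i].
    by exists x^T; rewrite ?trmxK// => i; rewrite /= mxE in_itv; exact: xc.
  by have := vA i; rewrite /= in_itv mxE.
by apply: continuous_compact cA; exact: continuous_subspaceT.
Qed.

Lemma period_cell_reduce x : exists z, period_cell (x + lattice_vec z).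
Proof.
exists (fun i => - Num.floor (x i 0 / a i)) => i; rewrite !mxE rmorphN/= mulrN.
have /andP[] := floor_itv (x i 0 / a i).
rewrite ler_pdivlMr// ltr_pdivrMr// rmorphD/= mulrDl mul1r.
set t := (Num.floor _)%:~R; rewrite (mulrC (a i)) => h1 h2.
by rewrite subr_ge0 h1/= lerBlDr addrC ltW.
Qed.

Lemma cperiodic_bounded f : cperiodic f -> exists B, forall x, `|f x| <= B.
Proof.
move=> [fc fp].
have : compact [set f x | x in period_cell].
  by apply: continuous_compact period_cell_compact; exact: continuous_subspaceT.
move=> /compact_bounded[M [_ /(_ (M + 1))]].
rewrite ltrDl ltr01 => /(_ isT) fM; exists (M + 1) => x.
have [z xz] := period_cell_reduce x; rewrite -(fp z).
by apply: fM; exists (x + lattice_vec z).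
Qed.

Lemma periodic_unif_continuous f (e : R) : cperiodic f -> 0 < e ->
  exists2 d, 0 < d & forall x y, ball x d y -> `|f x - f y| < e.
Proof.
move=> [fc fp] e0.
pose P (d : R) x := forall y, ball x d y -> `|f x - f y| < e.
have /(_ R (0^'+) P _) := (compact_near_coveringP _).1 period_cell_compact.
case=> [x _|d /= d0 dP].
  have /cvgrPdist_lt/(_ (e / 2)) := fc x; rewrite divr_gt0// => /(_ isT).
  move=> /nbhs_ballP[d /= d0 xd].
  exists (ball x (d / 2), [set t | 0 < t < d / 2]) => /=.
    split; first by apply: nbhsx_ballx; rewrite divr_gt0.
    near=> t; apply/andP; split; near: t; first exact: nbhs_right_gt.
    by apply: nbhs_right_lt; rewrite divr_gt0.
  move=> [y t]/= [xy /andP[t0 td]] w yw.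
  have xw : ball x d w.
    rewrite [d]splitr; apply: ball_triangle xy _.
    by apply: le_ball yw; rewrite ltW.
  have xy' : ball x d y by apply: le_ball xy; rewrite ler_pdivrMr//; lra.
  rewrite [e]splitr (le_lt_trans (ler_distD (f x) _ _))// ltrD//.
    by rewrite distrC; exact: xd.
  exact: xd.
exists (d / 2); first by rewrite divr_gt0.
move=> x y xy; have [z xz] := period_cell_reduce x.
rewrite -(fp z x) -(fp z y); apply: (dP (d / 2)) => //=.
- by rewrite sub0r normrN gtr0_norm ?divr_gt0// ltr_pdivrMr//; lra.
- by rewrite divr_gt0.
move: xy; rewrite -!ball_normE/=; congr (is_true (`|_| < _)).
by rewrite opprD addrACA subrr addr0.
Unshelve. all: by end_near. Qed.

Definition pow2 p : R := (2 ^ p)%:R.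

Lemma pow2_gt0 p : 0 < pow2 p.
Proof. by rewrite ltr0n expn_gt0. Qed.

(** The points of the grid with [2 ^ p] steps per period. Powers of two make the
    grids nested. *)
Definition grid_vec p (k : 'I_n -> nat) : 'cV[R]_n :=
  \col_i (a i * (k i)%:R / pow2 p).

(* (2 ^ p).-1.+1 is 2 ^ p, written so that the ordinals form a group: the cyclic
   group by which the grid translations act. *)
Local Notation grid p := {ffun 'I_n -> 'I_(2 ^ p).-1.+1}.

Definition grid_avg p f : R :=
  (\sum_(j : grid p) f (grid_vec p (fun i => j i : nat))) / #|grid p|%:R.

Lemma card_grid_gt0 p : 0 < #|grid p|%:R :> R.
Proof. by rewrite ltr0n; apply/card_gt0P; exists 0. Qed.

(** A translation by a grid vector permutes the grid modulo the lattice. *)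
Lemma grid_avg_shift p k f : lattice_periodic f ->
  grid_avg p (fun x => f (x + grid_vec p k)) = grid_avg p f.
Proof.
move=> fp; congr (_ / _).
rewrite [RHS](reindex_inj (addIr [ffun i => inZp (k i)])) /=.
apply: eq_bigr => j _.
rewrite -[RHS](fp (fun i => ((j i + k i) %/ 2 ^ p)%N%:Z)); congr f.
apply/colP => i; rewrite !mxE !ffunE /= modnDmr -pmulrn.
move: (nat_of_ord (j i)) (k i) => J K.
have -> : (2 ^ p).-1.+1 = (2 ^ p)%N by rewrite prednK// expn_gt0.
have /(congr1 (fun m => m%:R : R)) := divn_eq (J + K) (2 ^ p).
rewrite !natrD natrM -/(pow2 p) => E.
have -> : J%:R =
    ((J + K) %/ 2 ^ p)%:R * pow2 p + ((J + K) %% 2 ^ p)%:R - K%:R :> R.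
  by rewrite -E addrK.
have := pow2_gt0 p; move: (pow2 p) => g g0.
by field; rewrite gt_eqF.
Qed.

Lemma grid_avgD p f g :
  grid_avg p (fun x => f x + g x) = grid_avg p f + grid_avg p g.
Proof. by rewrite /grid_avg big_split mulrDl. Qed.

Lemma grid_avgZ p c f : grid_avg p (fun x => c * f x) = c * grid_avg p f.
Proof. by rewrite /grid_avg -mulr_sumr mulrA. Qed.

Lemma grid_avg_cst p c : grid_avg p (fun=> c) = c.
Proof.
rewrite /grid_avg sumr_const -[c *+ _]mulr_natr mulfK//.
by rewrite gt_eqF// card_grid_gt0.
Qed.

Lemma grid_avg_le p f g : (forall x, f x <= g x) ->
  grid_avg p f <= grid_avg p g.
Proof.
move=> fg; rewrite ler_pM2r ?invr_gt0 ?card_grid_gt0//.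
by apply: ler_sum => j _; exact: fg.
Qed.

Lemma grid_avg_norm_le p f c : (forall x, `|f x| <= c) -> `|grid_avg p f| <= c.
Proof.
move=> fc; have fc' x : - c <= f x <= c by rewrite -ler_norml.
have lo : grid_avg p (fun=> - c) <= grid_avg p f.
  by apply: grid_avg_le => x; case/andP: (fc' x).
have up : grid_avg p f <= grid_avg p (fun=> c).
  by apply: grid_avg_le => x; case/andP: (fc' x).
by move: lo up; rewrite !grid_avg_cst ler_norml => -> ->.
Qed.

(** The averages over the grids do converge in the usual sense, but a limit
    along an ultrafilter is enough and needs only that they are bounded. *)
Definition nat_ultra : set_system nat :=
  sval (cid (ultraFilterLemma eventually_filter)).

Lemma nat_ultraP : UltraFilter nat_ultra.
Proof. by rewrite /nat_ultra; case: cid => ? []. Qed.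

Lemma nat_ultra_eventually (P : set nat) :
  (\forall p \near \oo, P p) -> nat_ultra P.
Proof. by rewrite /nat_ultra; case: cid => /= F [_]; exact. Qed.

#[local] Instance nat_ultra_proper : ProperFilter nat_ultra.
Proof. exact: (@ultra_proper _ _ nat_ultraP). Qed.

Lemma ultra_bounded_cvg (s : nat -> R) (B : R) : (forall p, `|s p| <= B) ->
  cvg (s p @[p --> nat_ultra]).
Proof.
move=> sB.
have UF : UltraFilter (s p @[p --> nat_ultra]).
  split; first exact: fmap_proper_filter.
  move=> F PF sF; apply/seteqP; split=> A; last exact: sF.
  move=> FA; have [//|sA] := in_ultra_setVsetC (s @^-1` A) nat_ultraP.
  have : F (A `&` ~` A) by apply: filterI => //; apply: sF.
  by rewrite setICr => /filter_not_empty.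
have := @segment_compact R (- B) B; rewrite compact_ultra => /(_ _ UF)[].
  have sI : nat_ultra (s @^-1` `[- B, B]%classic).
    by apply: filterE => p; rewrite /= in_itv/= -ler_norml; exact: sB.
  exact: sI.
by move=> l [_ sl]; apply/cvg_ex; exists l.
Qed.

Definition mean f : R := lim (grid_avg p f @[p --> nat_ultra]).

Lemma mean_cvg f : cperiodic f -> grid_avg p f @[p --> nat_ultra] --> mean f.
Proof.
move=> /cperiodic_bounded[B fB].
apply: (@ultra_bounded_cvg (grid_avg^~ f) B) => p.
exact: grid_avg_norm_le.
Qed.

Lemma meanD f g : cperiodic f -> cperiodic g ->
  mean (fun x => f x + g x) = mean f + mean g.
Proof.
move=> cf cg; apply: cvg_lim => //.
rewrite (_ : (fun p => _) = (grid_avg^~ f) \+ (grid_avg^~ g)).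
  by apply: cvgD; exact: mean_cvg.
by apply/funext => p; rewrite grid_avgD.
Qed.

Lemma meanZ c f : cperiodic f -> mean (fun x => c * f x) = c * mean f.
Proof.
move=> cf; apply: cvg_lim => //.
rewrite (_ : (fun p => _) = (fun p => c * grid_avg p f)).
  by apply: cvgMl_tmp; exact: mean_cvg.
by apply/funext => p; rewrite grid_avgZ.
Qed.

Lemma mean_cst c : mean (fun=> c) = c.
Proof.
apply: cvg_lim => //; rewrite (_ : (fun p => _) = cst c); first exact: cvg_cst.
by apply/funext => p; rewrite grid_avg_cst.
Qed.

Lemma mean_ge f c :
  cperiodic f -> (\forall p \near \oo, c <= grid_avg p f) -> c <= mean f.
Proof.
move=> /mean_cvg cf /nat_ultra_eventually H.
exact: cvgr_to_ge cf H.
Qed.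

Lemma mean_le f g : cperiodic f -> cperiodic g -> (forall x, f x <= g x) ->
  mean f <= mean g.
Proof.
move=> /mean_cvg cf /mean_cvg cg fg; apply: ler_cvg_to cf cg _.
by apply: nearW => p; exact: grid_avg_le.
Qed.

Lemma pow2_large (c d : R) : 0 < d -> \forall p \near \oo, c / pow2 p < d.
Proof.
move=> d0; exists (Num.truncn `|c / d|).+1 => // p /= cp.
rewrite ltr_pdivrMr ?pow2_gt0// mulrC -ltr_pdivrMr//.
apply: le_lt_trans (ler_norm _) _; apply: lt_le_trans (truncnS_gt _) _.
by rewrite ler_nat (leq_trans cp)// ltnW// ltn_expl.
Qed.

(** A difference quotient whose step is the mesh of the grid has average 0; by
    the mean value theorem and uniform continuity it is uniformly close to the
    derivative when the mesh is small. *)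
Lemma mean_derive u i : (forall x, derivable u x (basis_vec i)) ->
  lattice_periodic u -> cperiodic ('D_(basis_vec i) u) ->
  mean ('D_(basis_vec i) u) = 0.
Proof.
move=> du pu cDu; apply/eqP; rewrite -normr_le0; apply/ler_addgt0Pl => e e0.
rewrite addr0.
have [d d0 ud] := periodic_unif_continuous cDu e0.
suff H : \forall p \near \oo, `|grid_avg p ('D_(basis_vec i) u)| <= e.
  have cN := cvg_norm (mean_cvg cDu).
  apply: (cvgr_to_le (cN _)).
  exact: nat_ultra_eventually.
near=> p.
have hd : a i / pow2 p < d by near: p; exact: pow2_large.
pose h := a i / pow2 p; pose k (j : 'I_n) : nat := j == i.
have h0 : 0 < h by rewrite divr_gt0// pow2_gt0.
have sE : grid_vec p k = h *: basis_vec i.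
  apply/colP => j; rewrite !mxE eqxx andbT /k.
  by have [->|_] := eqVneq; rewrite ?mulr1// mulr0 mul0r mulr0.
(* The opposite of the difference quotient is added for free. *)
have avg0 :
    grid_avg p (fun x => - h^-1 * (u (x + h *: basis_vec i) + -1 * u x)) = 0.
  rewrite grid_avgZ grid_avgD grid_avgZ -sE grid_avg_shift//.
  by rewrite mulN1r subrr mulr0.
rewrite -[grid_avg p _]addr0 -avg0 -grid_avgD; apply: grid_avg_norm_le => x.
have [t /andP[t0 th]] := MVT_line x h0 du; rewrite mulN1r => ->.
rewrite mulNr mulrCA mulVf ?gt_eqF// mulr1; apply/ltW/ud.
split=> // j k'; rewrite !mxE /ball/= opprD addrA subrr sub0r normrN.
rewrite normrM ger0_norm// (le_lt_trans _ (le_lt_trans th hd))//.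
by rewrite ler_piMr//; case: (_ && _); rewrite ?normr1// normr0 ler01.
Unshelve. all: by end_near. Qed.

Lemma ball_coord x y (d : R) : 0 < d -> (forall i, `|x i 0 - y i 0| < d) ->
  ball x d y.
Proof. by move=> d0 xy; split=> // i j; rewrite ord1; exact: xy. Qed.

(** A real number is within one step of an integer multiple of the step; the
    multiple splits into a position on the grid and a vector of the lattice. *)
Lemma grid_near q x y (d : R) : (forall i, a i / pow2 q < d) -> 0 < d ->
  exists (k : {ffun 'I_n -> 'I_(2 ^ q).-1.+1}) (z : 'I_n -> int),
    ball y d (x + grid_vec q (fun i => k i : nat) + lattice_vec z).
Proof.
move=> ad d0.
(* The integer [m i] counts grid steps from [x] to [y]; its remainder selects
   the grid vector and its quotient the lattice vector. *)
pose m i : int := Num.floor (pow2 q * (y i 0 - x i 0) / a i).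
have N0 : (0 < 2 ^ q)%N by rewrite expn_gt0.
exists [ffun i => inZp (absz (m i %% (2 ^ q)%N)%Z)].
exists (fun i => (m i %/ (2 ^ q)%N)%Z).
apply: ball_coord => // i; rewrite !mxE ffunE /=.
rewrite (_ : (2 ^ q).-1.+1 = (2 ^ q)%N) ?prednK//.
rewrite modn_small; last first.
  by rewrite -ltz_nat gez0_abs ?modz_ge0 ?ltz_pmod// gt_eqF.
have m0 : 0 <= (m i %% (2 ^ q)%N)%Z by rewrite modz_ge0// gt_eqF.
rewrite natr_absz (ger0_norm m0).
have /(congr1 (fun m => m%:~R : R)) := divz_eq (m i) (2 ^ q)%N.
rewrite rmorphD rmorphM/= -pmulrn -/(pow2 q).
have /andP[] := floor_itv (pow2 q * (y i 0 - x i 0) / a i).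
rewrite -/(m i) ler_pdivlMr// ltr_pdivrMr// rmorphD/=.
set M := (m i)%:~R; set D := (_ %/ _)%Z%:~R; set r := (_ %% _)%Z%:~R.
have g0 := pow2_gt0 q; have := ad i; rewrite ltr_pdivrMr//.
have := a0 i; move: (a i) (pow2 q) (y i 0) (x i 0) g0.
move=> A g Y X g0 A0 Ag h1 h2 E.
have -> : Y - (X + A * r / g + A * D) = (g * (Y - X) - M * A) / g.
  by rewrite E; field; rewrite gt_eqF.
rewrite normrM normfV (gtr0_norm g0) ltr_pdivrMr// ger0_norm ?subr_ge0//.
by apply: lt_trans Ag; lra.
Qed.

(** The sum of the translates of [f] along a fixed fine grid is bounded below by
    a positive constant, and all these translates have the same averages. *)
Lemma mean_gt0 f x :
  cperiodic f -> (forall x, 0 <= f x) -> 0 < f x -> 0 < mean f.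
Proof.
move=> cf f0 fx.
have fx2 : 0 < f x / 2 by rewrite divr_gt0.
have [d d0 fd] := periodic_unif_continuous cf fx2.
have [q aq] : exists q, forall i, a i / pow2 q < d.
  have : \forall q \near \oo, forall i, a i / pow2 q < d.
    by apply: filter_forall => i; exact: pow2_large.
  by move=> [q _ H]; exists q; exact: (H q (leqnn q)).
pose G := {ffun 'I_n -> 'I_(2 ^ q).-1.+1}.
have H y : f x / 2 <= \sum_(k : G) f (y + grid_vec q (fun i => k i : nat)).
  have [k [z xk]] := grid_near y x aq d0.
  rewrite (bigD1 k)//=; rewrite -[leLHS]addr0 lerD ?sumr_ge0//.
  have := fd _ _ xk; rewrite cf.2 => /ltr_distlBl.
  by lra.
have G0 : 0 < #|G|%:R :> R by exact: card_grid_gt0.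
apply: (@lt_le_trans _ _ (f x / 2 / #|G|%:R)); first by rewrite !divr_gt0.
apply: mean_ge => //; exists q => // p /= qp.
rewrite ler_pdivrMr// -[leLHS](grid_avg_cst p).
apply: le_trans (grid_avg_le _ H) _.
suff -> :
    grid_avg p (fun y => \sum_(k : G) f (y + grid_vec q (fun i => k i : nat))) =
    \sum_(k : G) grid_avg p f by rewrite sumr_const mulr_natr.
rewrite /grid_avg exchange_big/= mulr_suml; apply: eq_bigr => k _.
rewrite -/(grid_avg p (fun y => f (y + grid_vec q (fun i => k i : nat)))).
suff -> : grid_vec q (fun i => k i : nat) =
    grid_vec p (fun i => k i * 2 ^ (p - q))%N.
  by apply: grid_avg_shift; exact: cf.2.
apply/colP => i; rewrite !mxE natrM /pow2 -(subnK qp) expnD natrM addnK.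
have := pow2_gt0 (p - q); have := pow2_gt0 q; rewrite /pow2.
move: (2 ^ (p - q))%:R (2 ^ q)%:R => u v v0 u0; field.
by rewrite !gt_eqF.
Qed.

End Periodic.

(** * Trigonometric waves *)

Section Wave.
Context {R : realType} {n : nat}.
Implicit Types (w : 'I_n -> R) (x : 'cV[R]_n) (A B : R).

Definition linform w x : R := \sum_i w i * x i 0.

Definition wave w A B x : R := A * cos (linform w x) + B * sin (linform w x).

Lemma linform_continuous w : continuous (linform w).
Proof.
move=> x; rewrite /linform -fct_sumE; elim/big_ind : _ => [|f g fc gc|i _].
- exact: cst_continuous.
- exact: continuousD.
- by apply: continuousM; [exact: cst_continuous|exact: coord_continuous].
Qed.

Lemma linformD w x y : linform w (x + y) = linform w x + linform w y.
Proof. by rewrite -big_split; apply: eq_bigr => i _; rewrite mxE mulrDr. Qed.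

Lemma linform_line w x i (t : R) :
  linform w (x + t *: basis_vec i) = linform w x + t * w i.
Proof.
rewrite linformD; congr (_ + _); rewrite /linform (bigD1 i)//= big1 => [|j ji].
  by rewrite !mxE !eqxx mulr1 addr0 mulrC.
by rewrite !mxE (negPf ji) !mulr0.
Qed.

Lemma wave_continuous w A B : continuous (wave w A B).
Proof.
move=> x; apply: (@continuousD _ _ _ (fun y => A * cos (linform w y))
    (fun y => B * sin (linform w y))).
- apply: (@continuousM _ _ (cst A) (fun y => cos (linform w y)));
    first exact: cst_continuous.
  by apply: continuous_comp; [exact: linform_continuous|exact: continuous_cos].
- apply: (@continuousM _ _ (cst B) (fun y => sin (linform w y)));
    first exact: cst_continuous.
  by apply: continuous_comp; [exact: linform_continuous|exact: continuous_sin].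
Qed.

Lemma is_derive_trig (A B c d s : R) :
  is_derive s (1 : R) (fun t : R => A * cos (c + t * d) + B * sin (c + t * d))
    (d * B * cos (c + s * d) + - (d * A) * sin (c + s * d)).
Proof.
pose l := (cst c + d \*: (id : R -> R)).
have dl : is_derive s (1 : R) l d.
  have := is_deriveD (is_derive_cst c s 1) (is_deriveZ d (is_derive_id s (1 :
  R))).
  by rewrite add0r [_ *: _]mulr1.
have lE t : l t = c + t * d by rewrite /l /= mulrC.
have dc := is_deriveZ A (is_derive1_comp (is_derive_cos (l s)) dl).
have ds := is_deriveZ B (is_derive1_comp (is_derive_sin (l s)) dl).
have := is_deriveD dc ds.
rewrite (_ : _ + _ = fun t : R => A * cos (c + t * d) + B * sin (c + t * d)).
  move=> h; apply: is_derive_eq h _.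
  by rewrite lE /GRing.scale/=; ring.
by apply/funext => t; rewrite -lE.
Qed.

(** For fixed [w] the waves form a space stable under partial derivatives, which
    makes smoothness an induction. *)
Lemma is_derive_wave w A B x i :
  is_derive x (basis_vec i) (wave w A B) (wave w (w i * B) (- (w i * A)) x).
Proof.
apply: is_derive_line.
have := is_derive_trig A B (linform w x) (w i) 0; rewrite mul0r addr0.
rewrite (_ : (fun t => _) =
  fun t : R => A * cos (linform w x + t * w i) + B * sin (linform w x + t * w
  i))//.
by apply/funext => t; rewrite /wave linform_line.
Qed.

Lemma derive_waveE w A B i x :
  'D_(basis_vec i) (wave w A B) x = wave w (w i * B) (- (w i * A)) x.
Proof. by have [_ ->] := is_derive_wave w A B x i. Qed.

Lemma derive_wave w A B i :
  'D_(basis_vec i) (wave w A B) = wave w (w i * B) (- (w i * A)).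
Proof. by apply/funext => x; rewrite derive_waveE. Qed.

Lemma derivable_wave w A B x i : derivable (wave w A B) x (basis_vec i).
Proof. by have [] := is_derive_wave w A B x i. Qed.

Lemma smooth_wave w A B : smooth_on setT (wave w A B).
Proof.
move=> k; elim: k A B => [|k IH] A B /=.
  by split=> // x _; exact: wave_continuous.
split=> [x _|i]; first exact: wave_continuous.
by split=> [x _|]; [exact: derivable_wave|rewrite derive_wave; exact: IH].
Qed.

Lemma laplacian_wave w A B x :
  laplacian (wave w A B) x = (\sum_i w i ^+ 2) * wave w A B x.
Proof.
rewrite /laplacian -sumrN mulr_suml; apply: eq_bigr => i _.
by rewrite derive_wave derive_waveE /wave; ring.
Qed.

End Wave.

(** * The Hartley functions of a rectangular torus *)

Section Fourier.
Context {R : realType} {n : nat} (a : 'I_n -> R).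
Hypothesis a0 : forall i, 0 < a i.
Implicit Types (f g u v : 'cV[R]_n -> R) (x y : 'cV[R]_n) (A B : R).
Implicit Types k l : {ffun 'I_n -> int}.

Lemma cperiodicD f g :
  cperiodic a f -> cperiodic a g -> cperiodic a (fun x => f x + g x).
Proof.
move=> [fc fp] [gc gp]; split; last by move=> z x; rewrite fp gp.
by move=> x; exact: (continuousD (fc x) (gc x)).
Qed.

Lemma cperiodicM f g :
  cperiodic a f -> cperiodic a g -> cperiodic a (fun x => f x * g x).
Proof.
move=> [fc fp] [gc gp]; split; last by move=> z x; rewrite fp gp.
by move=> x; exact: (continuousM (fc x) (gc x)).
Qed.

Lemma cperiodic_cst A : cperiodic a (fun=> A).
Proof. by split=> // x; exact: cst_continuous. Qed.

Lemma cperiodicZ A f : cperiodic a f -> cperiodic a (fun x => A * f x).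
Proof. by move=> cf; apply: cperiodicM => //; exact: cperiodic_cst. Qed.

Lemma cperiodic_sum (I : finType) (F : I -> 'cV[R]_n -> R) :
  (forall i, cperiodic a (F i)) -> cperiodic a (fun x => \sum_i F i x).
Proof.
move=> cF; elim: index_enum => [|i s IH].
  by under eq_fun do rewrite big_nil; exact: cperiodic_cst.
by under eq_fun do rewrite big_cons; exact: cperiodicD.
Qed.

Lemma mean_sum (I : finType) (F : I -> 'cV[R]_n -> R) :
  (forall i, cperiodic a (F i)) ->
  mean a (fun x => \sum_i F i x) = \sum_i mean a (F i).
Proof.
move=> cF.
suff [] : cperiodic a (fun x => \sum_i F i x) /\
  mean a (fun x => \sum_i F i x) = \sum_i mean a (F i) by [].
elim: index_enum => [|i s [cs IH]].
  under eq_fun do rewrite big_nil; rewrite big_nil mean_cst.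
  by split=> //; exact: cperiodic_cst.
under eq_fun do rewrite big_cons; rewrite big_cons meanD// IH.
by split=> //; exact: cperiodicD.
Qed.

Definition freq k i : R := pi *+ 2 * (k i)%:~R / a i.

Definition eigval k : R := \sum_i freq k i ^+ 2.

Lemma freq0 : freq 0 = fun=> 0.
Proof. by apply/funext => i; rewrite /freq ffunE mulr0 mul0r. Qed.

Lemma linform_freqD k l x :
  linform (freq (k + l)) x = linform (freq k) x + linform (freq l) x.
Proof.
rewrite -big_split; apply: eq_bigr => i _.
by rewrite /freq ffunE rmorphD/=; ring.
Qed.

Lemma linform_freqN k x : linform (freq (- k)) x = - linform (freq k) x.
Proof.
rewrite -sumrN; apply: eq_bigr => i _.
by rewrite /freq ffunE rmorphN/=; ring.
Qed.

Lemma linform_freq_lattice k z :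
  linform (freq k) (lattice_vec a z) = pi *+ 2 * (\sum_i k i * z i)%:~R.
Proof.
rewrite rmorph_sum/= mulr_sumr; apply: eq_bigr => i _.
rewrite /freq mxE rmorphM/=; field.
by rewrite gt_eqF.
Qed.

Lemma cosDz (t : R) (m : int) : cos (t + pi *+ 2 * m%:~R) = cos t.
Proof.
have cosDn s p : cos (s + pi *+ 2 * p%:R) = cos s :> R.
  by rewrite mulr_natr; exact: periodicn (@cosD2pi R) _ _.
case: m => p; first exact: cosDn.
by rewrite NegzE rmorphN/= -(cosDn _ p.+1) mulrN subrK.
Qed.

Lemma sinDz (t : R) (m : int) : sin (t + pi *+ 2 * m%:~R) = sin t.
Proof.
have sinDn s p : sin (s + pi *+ 2 * p%:R) = sin s :> R.
  by rewrite mulr_natr; exact: periodicn (@sinD2pi R) _ _.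
case: m => p; first exact: sinDn.
by rewrite NegzE rmorphN/= -(sinDn _ p.+1) mulrN subrK.
Qed.

Lemma cperiodic_wave k A B : cperiodic a (wave (freq k) A B).
Proof.
split=> [|z x]; first exact: wave_continuous.
by rewrite /wave linformD linform_freq_lattice cosDz sinDz.
Qed.

(** If [k i != 0], the wave is the [i]-th partial derivative of another wave
    with the same periods. *)
Lemma mean_wave k A B : mean a (wave (freq k) A B) = A *+ (k == 0).
Proof.
have [->|k0] := eqVneq k 0.
  rewrite (_ : wave _ _ _ = fun=> A) ?mean_cst//.
  apply/funext => x; rewrite /wave (_ : linform _ _ = 0).
    by rewrite cos0 sin0 mulr0 mulr1 addr0.
  by rewrite /linform freq0 big1// => i _; rewrite mul0r.
have [i ki] : exists i, k i != 0.
  apply/existsP; apply: contraNT k0 => /existsPn k0; apply/eqP/ffunP => i.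
  by rewrite ffunE; apply/eqP; rewrite -[_ == _]negbK k0.
have wi : freq k i != 0.
  have pi2 : pi *+ 2 != 0 :> R by rewrite mulrn_eq0/= gt_eqF ?pi_gt0.
  by rewrite !mulf_neq0 ?invr_eq0 ?intr_eq0// gt_eqF.
have DE : 'D_(basis_vec i) (wave (freq k) (- (B / freq k i)) (A / freq k i)) =
    wave (freq k) A B.
  by rewrite derive_wave; congr wave; field.
rewrite -DE mulr0n; apply: mean_derive => //.
- by move=> x; exact: derivable_wave.
- by have [] := cperiodic_wave k (- (B / freq k i)) (A / freq k i).
- by rewrite DE; exact: cperiodic_wave.
Qed.

(** The sum of cosine and sine is preferred to the pair: it gives one real
    function per frequency, so that bases of eigenspaces are indexed by integer
    vectors without choosing between [k] and [- k]. *)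
Definition hartley k : 'cV[R]_n -> R := wave (freq k) 1 1.

(** Writing [s] and [t] for the two phases, the product is [cos (s - t) + sin (s
    + t)]; the mean of the second term vanishes even at frequency 0. *)
Lemma mean_hartley k l :
  mean a (fun x => hartley k x * hartley l x) = (k == l)%:R.
Proof.
rewrite (_ : (fun x => _) = fun x =>
    wave (freq (k - l)) 1 0 x + wave (freq (k + l)) 0 1 x).
  rewrite meanD //; try exact: cperiodic_wave.
  by rewrite !mean_wave mul0rn addr0 subr_eq0.
apply/funext => x; rewrite /hartley /wave !linform_freqD linform_freqN.
by rewrite cosB [sin (_ + linform _ _)]sinD; ring.
Qed.

(** The span of the Hartley functions is stable under products with waves. *)
Lemma wave_mul_hartley k l A B x : wave (freq k) A B x * hartley l x =
  A / 2 * (hartley (k + l) x + hartley (l - k) x) +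
  B / 2 * (hartley (k - l) x - hartley (- (k + l)) x).
Proof.
rewrite /hartley /wave !linform_freqD !linform_freqN !linform_freqD.
set s := linform _ x; set t := linform _ x.
rewrite !(cosN, sinN, cosD, sinD).
by field.
Qed.

Lemma derive_lattice_periodic u (e : 'cV[R]_n) :
  lattice_periodic a u -> lattice_periodic a ('D_e u).
Proof.
move=> up z x.
have E : (fun h : R => h^-1 *: ((u \o shift (x + lattice_vec a z)) (h *: e) -
    u (x + lattice_vec a z))) =
    (fun h => h^-1 *: ((u \o shift x) (h *: e) - u x)).
  by apply/funext => h /=; rewrite up addrA up.
by rewrite /derive E.
Qed.

Definition periodic_C1 i u :=
  [/\ cperiodic a u, forall x, derivable u x (basis_vec i) &
     continuous ('D_(basis_vec i) u)].

(** The mean of the partial derivative of [u * v] vanishes. *)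
Lemma mean_by_parts i u v : periodic_C1 i u -> periodic_C1 i v ->
  mean a (fun x => 'D_(basis_vec i) u x * v x) =
  - mean a (fun x => u x * 'D_(basis_vec i) v x).
Proof.
move=> [cu du uc] [cv dv vc].
have cDu : cperiodic a ('D_(basis_vec i) u).
  by split; [exact: uc|apply: derive_lattice_periodic; case: cu].
have cDv : cperiodic a ('D_(basis_vec i) v).
  by split; [exact: vc|apply: derive_lattice_periodic; case: cv].
have DE : 'D_(basis_vec i) (u * v) = fun x =>
    u x * 'D_(basis_vec i) v x + 'D_(basis_vec i) u x * v x.
  by apply/funext => x; rewrite deriveM// /GRing.scale/= [v x * _]mulrC.
have c1 : cperiodic a (fun x => u x * 'D_(basis_vec i) v x).
  exact: cperiodicM.
have c2 : cperiodic a (fun x => 'D_(basis_vec i) u x * v x).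
  exact: cperiodicM.
have : mean a ('D_(basis_vec i) (u * v)) = 0.
  apply: mean_derive; first exact: a0.
  - by move=> x; exact: derivableM.
  - by have [] := cperiodicM cu cv.
  - by rewrite DE; exact: cperiodicD.
by rewrite DE meanD// addrC => /eqP; rewrite addr_eq0 => /eqP.
Qed.

Lemma periodic_C1_wave i k A B : periodic_C1 i (wave (freq k) A B).
Proof.
split; [exact: cperiodic_wave|by move=> x; exact: derivable_wave|].
by rewrite derive_wave; exact: wave_continuous.
Qed.

Lemma mean_by_parts_wave i u k A B : periodic_C1 i u ->
  mean a (fun x => 'D_(basis_vec i) u x * wave (freq k) A B x) =
  - mean a (fun x => u x *
      wave (freq k) (freq k i * B) (- (freq k i * A)) x).
Proof.
move=> cu; rewrite (mean_by_parts cu (periodic_C1_wave i k A B)).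
by congr (- mean a _); apply/funext => x; rewrite derive_waveE.
Qed.

(** The Laplacian is symmetric for the mean: the mean of [laplacian u * hartley
    k] is [mu], and also [eigval k], times the mean of [u * hartley k]. *)
Lemma mean_eigenfunction u (mu : R) k :
  smooth_on setT u -> lattice_periodic a u ->
  (forall x, laplacian u x = mu * u x) -> eigval k != mu ->
  mean a (fun x => u x * hartley k x) = 0.
Proof.
move=> us up ue kmu.
have [uc /= uD] := us 2%N.
have c1 i : periodic_C1 i u.
  split; last by move=> x; have [] := uD i => _ [+ _]; apply.
  - by split=> // x; exact: uc.
  - by move=> x; have [+ _] := uD i; apply.
have c2 i : periodic_C1 i ('D_(basis_vec i) u).
  have [_ [Dc DD]] := uD i; have [D1 [D2 _]] := DD i.
  split; [split|by move=> x; apply: D1|by move=> x; apply: D2].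
    by move=> x; exact: Dc.
  exact: derive_lattice_periodic.
have ch : cperiodic a (hartley k) by exact: cperiodic_wave.
have cu : cperiodic a u by split=> // x; exact: uc.
have E i :
    mean a (fun x => 'D_(basis_vec i) ('D_(basis_vec i) u) x * hartley k x) =
    - freq k i ^+ 2 * mean a (fun x => u x * hartley k x).
  rewrite (mean_by_parts_wave _ _ _ (c2 i)) (mean_by_parts_wave _ _ _ (c1 i)).
  rewrite opprK -meanZ//; last exact: cperiodicM.
  congr mean; apply/funext => x; rewrite /hartley /wave; ring.
have cDD i :
    cperiodic a (fun x => 'D_(basis_vec i) ('D_(basis_vec i) u) x * hartley k x).
  apply: cperiodicM; last exact: ch.
  have [[_ p] _ c] := c2 i; split; first exact: c.
  exact: derive_lattice_periodic.
have : mu * mean a (fun x => u x * hartley k x) =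
    eigval k * mean a (fun x => u x * hartley k x).
  rewrite -meanZ//; last exact: cperiodicM.
  rewrite (_ : (fun x => _) = fun x =>
    \sum_i -1 * ('D_(basis_vec i) ('D_(basis_vec i) u) x * hartley k x)).
    rewrite mean_sum => [|i]; last exact: cperiodicZ.
    rewrite /eigval mulr_suml; apply: eq_bigr => i _.
    by rewrite meanZ// E; ring.
  apply/funext => x; rewrite mulrA -ue /laplacian -mulr_sumr -mulr_suml.
  by rewrite mulN1r mulNr.
move=> /eqP; rewrite -subr_eq0 -mulrBl mulf_eq0 subr_eq0 eq_sym (negPf kmu).
by move=> /eqP.
Qed.

Definition hartley_null g :=
  cperiodic a g /\ forall k, mean a (fun x => g x * hartley k x) = 0.

Lemma hartley_nullD f g :
  hartley_null f -> hartley_null g -> hartley_null (fun x => f x + g x).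
Proof.
move=> [cf fo] [cg go]; split=> [|k]; first exact: cperiodicD.
under eq_fun do rewrite mulrDl.
by rewrite meanD ?fo ?go ?addr0//; apply: cperiodicM => //; 
  exact: cperiodic_wave.
Qed.

Lemma hartley_nullZ A f : hartley_null f -> hartley_null (fun x => A * f x).
Proof.
move=> [cf fo]; split=> [|k]; first exact: cperiodicZ.
under eq_fun do rewrite -mulrA.
by rewrite meanZ ?fo ?mulr0//; apply: cperiodicM => //; exact: cperiodic_wave.
Qed.

Lemma hartley_null_sum (I : finType) (F : I -> 'cV[R]_n -> R) :
  (forall i, hartley_null (F i)) -> hartley_null (fun x => \sum_i F i x).
Proof.
move=> oF; elim: index_enum => [|i s IH].
  under eq_fun do rewrite big_nil; split; first exact: cperiodic_cst.
  by move=> k; under eq_fun do rewrite mul0r; exact: mean_cst.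
by under eq_fun do rewrite big_cons; exact: hartley_nullD.
Qed.

Lemma hartley_null_wave f k A B :
  hartley_null f -> hartley_null (fun x => f x * wave (freq k) A B x).
Proof.
move=> [cf fo]; split=> [|l]; first by apply: cperiodicM => //; 
  exact: cperiodic_wave.
have c m : cperiodic a (fun x => f x * hartley m x).
  by apply: cperiodicM => //; exact: cperiodic_wave.
rewrite (_ : (fun x => _) = fun x =>
  (A / 2 * (f x * hartley (k + l) x) + A / 2 * (f x * hartley (l - k) x)) +
  (B / 2 * (f x * hartley (k - l) x) + - (B / 2) * (f x * hartley (- (k + l))
  x))).
  rewrite !meanD ?meanZ ?fo ?mulr0 ?addr0//;
    by do ?[apply: cperiodicD]; apply: cperiodicZ.
by apply/funext => x; rewrite -mulrA wave_mul_hartley; ring.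
Qed.

End Fourier.

(** * Completeness of the Hartley functions *)

Section Complete.
Context {R : realType} {n : nat} (a : 'I_n -> R).
Hypothesis a0 : forall i, 0 < a i.
Implicit Types (f g u v : 'cV[R]_n -> R) (x y : 'cV[R]_n).

(** Reduce [t] modulo 1; on the interval from 0 to 1 one has [cos (2 pi s) = 1 -
    2 sin (pi s)^2], and the sine is positive inside. *)
Lemma cos_eq1 (t : R) : cos (pi *+ 2 * t) = 1 -> exists z : int, t = z%:~R.
Proof.
move=> ct; exists (Num.floor t).
have /andP[] := floor_itv t; rewrite rmorphD/=; set z := (_)%:~R => zt tz.
apply/eqP; rewrite -subr_eq0; apply/eqP.
set s := t - z; have s0 : 0 <= s by rewrite subr_ge0.
have s1 : s < 1 by rewrite ltrBlDl.
have cs : cos (pi *+ 2 * s) = 1.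
  by rewrite -ct -(cosDz _ (Num.floor t)) -mulrDr subrK.
have [//|sn0] := eqVneq s 0.
have ss : 0 < s by rewrite lt_neqAle eq_sym sn0.
have : 0 < sin (pi * s).
  by apply: sin_gt0_pi; rewrite mulr_gt0 ?pi_gt0//= gtr_pMr ?pi_gt0.
have : cos (pi *+ 2 * s) = 1 - sin (pi * s) ^+ 2 *+ 2.
  rewrite mulrnAl cos_mulr2n; have := cos2Dsin2 (pi * s).
  by move: (cos _ ^+ 2) (sin _ ^+ 2) => C S; rewrite !mulr2n; lra.
by rewrite cs; nra.
Qed.

(** A trigonometric polynomial that is 0 at the translates of [x0] by the
    lattice and negative elsewhere. *)
Definition cos_defect (x0 x : 'cV[R]_n) : R :=
  \sum_i (cos (pi *+ 2 * ((x i 0 - x0 i 0) / a i)) - 1).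

Definition unit_freq (i : 'I_n) : {ffun 'I_n -> int} :=
  [ffun j => ((j == i) : nat)%:Z].

Lemma linform_unit_freq i x :
  linform (freq a (unit_freq i)) x = pi *+ 2 * (x i 0 / a i).
Proof.
rewrite /linform (bigD1 i)//= big1 => [|j ji]; rewrite /freq ffunE.
  by rewrite eqxx addr0 mulr1 mulrA mulrAC.
by rewrite (negPf ji) mulr0 !mul0r.
Qed.

Lemma cos_defectE x0 x : cos_defect x0 x = \sum_i
  (wave (freq a (unit_freq i)) (cos (pi *+ 2 * (x0 i 0 / a i)))
      (sin (pi *+ 2 * (x0 i 0 / a i))) x - 1).
Proof.
apply: eq_bigr => i _; rewrite /wave linform_unit_freq mulrBl mulrBr cosB.
by congr (_ - 1); ring.
Qed.

Lemma cos_defect_le0 x0 x : cos_defect x0 x <= 0.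
Proof. by apply: sumr_le0 => i _; rewrite subr_le0 cos_le1. Qed.

Lemma cos_defect_ge x0 x : - 2 * n%:R <= cos_defect x0 x.
Proof.
have : \sum_(i < n) - 2 <= cos_defect x0 x.
  apply: ler_sum => i _.
  by have := cos_geN1 (pi *+ 2 * ((x i 0 - x0 i 0) / a i)); lra.
by rewrite sumr_const card_ord mulr_natr.
Qed.

Lemma cos_defect_eq0 x0 x :
  cos_defect x0 x = 0 -> exists z, x = x0 + lattice_vec a z.
Proof.
move=> b0.
have H i : exists z : int, (x i 0 - x0 i 0) / a i = z%:~R.
  apply: cos_eq1; apply/eqP; rewrite -subr_eq0 -oppr_eq0.
  have /eqP : \sum_i (1 - cos (pi *+ 2 * ((x i 0 - x0 i 0) / a i))) = 0.
    apply: etrans (_ : - cos_defect x0 x = 0); last by rewrite b0 oppr0.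
    by rewrite /cos_defect -sumrN; apply: eq_bigr => j _; rewrite opprB.
  rewrite psumr_eq0 => [/allP/(_ i)|j _]; last by rewrite subr_ge0 cos_le1.
  by rewrite mem_index_enum opprB => /(_ isT).
exists (fun i => sval (cid (H i))); apply/colP => i; rewrite !mxE.
by case: cid => z /= <-; field; rewrite gt_eqF.
Qed.

Lemma cperiodic_cos_defect x0 : cperiodic a (cos_defect x0).
Proof.
rewrite (_ : cos_defect x0 = fun x => \sum_i
  (wave (freq a (unit_freq i)) (cos (pi *+ 2 * (x0 i 0 / a i)))
      (sin (pi *+ 2 * (x0 i 0 / a i))) x - 1)); last first.
  by apply/funext => x; exact: cos_defectE.
apply: cperiodic_sum => i; apply: cperiodicD; first exact: cperiodic_wave.
exact: cperiodic_cst.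
Qed.

Lemma hartley_null_defect f x0 :
  hartley_null a f -> hartley_null a (fun x => f x * cos_defect x0 x).
Proof.
move=> fo; rewrite (_ : (fun x => _) = fun x => \sum_i
  (f x * wave (freq a (unit_freq i)) (cos (pi *+ 2 * (x0 i 0 / a i)))
      (sin (pi *+ 2 * (x0 i 0 / a i))) x + -1 * f x)).
  apply: (hartley_null_sum a0) => i; apply: (hartley_nullD a0); first exact:
  hartley_null_wave.
  exact: hartley_nullZ.
apply/funext => x; rewrite cos_defectE mulr_sumr; apply: eq_bigr => i _.
by rewrite mulrBr mulr1 mulN1r.
Qed.

(** On the compact set of points of the period cell where [f <= c] the defect
    reaches its maximum, which is negative since [f] takes the value [f x0] at
    all zeros of the defect. *)
Lemma cos_defect_gap f x0 (c : R) : cperiodic a f -> c < f x0 ->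
  exists2 d, 0 < d & forall x, f x <= c -> cos_defect x0 x <= - d.
Proof.
move=> [fc fp] cf.
pose K := period_cell a `&` f @^-1` [set t | t <= c].
have Kc : compact K.
  apply: compact_closedI; first exact: period_cell_compact.
  apply: preimage_closed; last exact: closed_le.
  by move=> x _; exact: fc.
have [K0|/set0P K0] := eqVneq K set0.
  exists 1 => // x fx; have [z xz] := period_cell_reduce a0 x.
  have : K (x + lattice_vec a z) by split=> //=; rewrite fp.
  by rewrite K0.
have [bc bp] := cperiodic_cos_defect x0.
have [x1 x1K x1max] := compact_EVT_max K0 Kc (continuous_subspaceT bc).
exists (- cos_defect x0 x1).
  rewrite oppr_gt0 lt_neqAle cos_defect_le0 andbT.
  apply/eqP => /cos_defect_eq0[z x1E].
  by move: x1K; rewrite inE => -[_ /=]; rewrite x1E fp leNgt cf.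
move=> x fx; rewrite opprK; have [z xz] := period_cell_reduce a0 x.
by rewrite -(bp z) x1max// inE; split=> //=; rewrite fp.
Qed.

Lemma bernoulli_ineq (k : R) m : 0 <= k -> 1 + m%:R * k <= (1 + k) ^+ m.
Proof.
move=> k0; elim: m => [|m IH]; first by rewrite mul0r addr0.
rewrite exprS -natr1; have : 0 <= m%:R :> R by [].
by move: IH; set P := _ ^+ _; set q := m%:R; nra.
Qed.

(** Suppose [f x0 > 0] and let [c] be half of it. The trigonometric polynomial
    [Q] has values in the interval from [-1] to [1 + k], it equals [1 + k] at
    [x0], and it is at most 1 wherever [f <= c]. The means of [f * Q ^ m] all
    vanish. On the other hand [f * Q ^ m] is at least [- B] everywhere and at
    least [c * (1 + k / 2) ^ m] close to [x0]: its mean tends to infinity. *)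
Lemma hartley_null_le0 f x0 : hartley_null a f -> f x0 <= 0.
Proof.
move=> fo; have [cf _] := fo; rewrite leNgt; apply/negP => fx0.
set c := f x0 / 2; have c0 : 0 < c by rewrite divr_gt0.
have [d d0 fd] :
    exists2 d, 0 < d & forall x, f x <= c -> cos_defect x0 x <= - d.
  by apply: cos_defect_gap => //; rewrite /c ltr_pdivrMr//; lra.
have n1 : 0 < n.+1%:R :> R by [].
have [k k0 kE] : exists2 k : R, 0 < k & d = n.+1%:R * k.
  by exists (d / n.+1%:R); [rewrite divr_gt0|rewrite mulrC divfK// gt_eqF].
pose Q x := (1 + k) + n.+1%:R^-1 * cos_defect x0 x.
have cQ : cperiodic a Q.
  apply: cperiodicD; first exact: cperiodic_cst.
  by apply: cperiodicZ; exact: cperiodic_cos_defect.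
have oQ g : hartley_null a g -> hartley_null a (fun x => g x * Q x).
  move=> go; rewrite (_ : (fun x => _) = fun x =>
    (1 + k) * g x + n.+1%:R^-1 * (g x * cos_defect x0 x)).
    apply: hartley_nullD; [exact: a0|exact: hartley_nullZ|].
    by apply: hartley_nullZ => //; exact: hartley_null_defect.
  by apply/funext => x; rewrite /Q; ring.
have ofQ m : hartley_null a (fun x => f x * Q x ^+ m).
  elim: m => [|m IH].
    by under eq_fun do rewrite expr0 mulr1.
  under eq_fun do rewrite exprSr mulrA; exact: oQ.
have Qle x : Q x <= 1 + k.
  by rewrite gerDl pmulr_rle0 ?invr_gt0// cos_defect_le0.
have Qge x : -1 <= Q x.
  have : -2 <= n.+1%:R^-1 * cos_defect x0 x.
    rewrite ler_pdivlMl//; apply: le_trans (cos_defect_ge x0 x).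
    by rewrite -natr1; lra.
  by rewrite /Q; move: (_ * cos_defect _ _) => t; lra.
have Qfar x : f x <= c -> Q x <= 1.
  move=> /fd bd; have : n.+1%:R^-1 * cos_defect x0 x <= - k.
    by rewrite ler_pdivrMl// mulrN -kE.
  by rewrite /Q; move: (_ * cos_defect _ _) => t; lra.
have Qx0 : Q x0 = 1 + k.
  rewrite /Q /cos_defect big1 ?mulr0 ?addr0// => i _.
  by rewrite subrr mul0r mulr0 cos0 subrr.
(* A bump below [k], supported where [Q > 1 + k / 2]; there [f > c]. *)
pose phi x := Num.max (Q x - (1 + k / 2)) 0.
have phi0 x : 0 <= phi x by rewrite le_max lexx orbT.
have cphi : cperiodic a phi.
  split=> [x|z x]; last by rewrite /phi cQ.2.
  apply: (@continuous_max R _ (fun x => Q x - (1 + k / 2)) (cst 0)).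
    apply: (@continuousD _ _ _ Q (cst (- (1 + k / 2)))); first exact: cQ.1.
    exact: cst_continuous.
  exact: cst_continuous.
have Mphi : 0 < mean a phi.
  apply: (mean_gt0 a0 (x := x0)) => //.
  by rewrite lt_max Qx0 subr_gt0 ltrD2l ltr_pdivrMr// ltr_pMr// ltr1n.
have [B fB] := cperiodic_bounded a0 cf.
have B0 : 0 <= B by apply: le_trans (fB x0).
(* The factor [c / k] normalizes the bump, so that [q m * phi] is at most [c *
   (1 + k / 2) ^+ m]. *)
pose q m := c / k * (1 + k / 2) ^+ m.
have q0 m : 0 <= q m.
  have ? : 0 <= 1 + k / 2 by lra.
  by apply: mulr_ge0; [apply/ltW/divr_gt0|exact: exprn_ge0].
have key m x : q m * phi x - B <= f x * Q x ^+ m.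
  have Bf := fB x.
  have [fc|cf'] := leP (f x) c.
    have Q1 := Qfar _ fc.
    have -> : phi x = 0 by apply/max_idPr; lra.
    rewrite mulr0 sub0r lerNl -mulNr.
    apply: le_trans (ler_norm _) _; rewrite normrM normrN normrX.
    rewrite -[leRHS]mulr1 ler_pM ?normr_ge0 ?exprn_ge0//.
    by rewrite exprn_ile1 ?normr_ge0// ler_norml Qge.
  have [Qs|Qb] := leP (Q x) (1 + k / 2).
    have -> : phi x = 0 by apply/max_idPr; lra.
    rewrite mulr0 sub0r; have [Qn|Qp] := leP 0 (Q x).
      rewrite (@le_trans _ _ 0) ?oppr_le0// mulr_ge0 ?exprn_ge0//.
      by rewrite ltW// (lt_trans c0).
    rewrite lerNl -mulNr.
    apply: le_trans (ler_norm _) _; rewrite normrM normrN normrX.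
    rewrite -[leRHS]mulr1 ler_pM ?normr_ge0 ?exprn_ge0//.
    by rewrite exprn_ile1 ?normr_ge0// ler_norml Qge/=; lra.
  have -> : phi x = Q x - (1 + k / 2) by apply/max_idPl; lra.
  apply: (@le_trans _ _ (q m * k)).
    rewrite lerBlDr; apply: (@le_trans _ _ (q m * k)); last by rewrite lerDl.
    by rewrite ler_wpM2l//; have := Qle x; lra.
  rewrite /q mulrAC divfK ?gt_eqF//.
  apply: ler_pM; rewrite ?exprn_ge0 ?(ltW c0) ?(ltW cf')//; first by lra.
  by rewrite lerXn2r ?nnegrE; lra.
have bound m : q m * mean a phi <= B.
  have : mean a (fun x => q m * phi x + - B) <=
      mean a (fun x => f x * Q x ^+ m).
    apply: (mean_le a0) => [||x]; [|exact: (ofQ m).1|exact: key].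
    by apply: cperiodicD; [exact: cperiodicZ|exact: cperiodic_cst].
  rewrite meanD ?meanZ ?mean_cst//; [|exact: cperiodicZ|exact: cperiodic_cst].
  have [_ /(_ 0)] := ofQ m.
  rewrite (_ : (fun x => _) = fun x => f x * Q x ^+ m); last first.
    apply/funext => x; rewrite /hartley /wave /linform freq0 big1 => [|i _].
      by rewrite cos0 sin0 mulr0 addr0 !mulr1.
    by rewrite mul0r.
  by move=> ->; rewrite subr_le0.
have ck : 0 < c / k * mean a phi * (k / 2).
  by rewrite !mulr_gt0 ?invr_gt0.
(* Linear growth of [q m] in [m], by Bernoulli's inequality, contradicts
   [bound]. *)
have [m Hm] : exists m : nat, B < m%:R * (c / k * mean a phi * (k / 2)).
  exists (Num.truncn (B / (c / k * mean a phi * (k / 2)))).+1.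
  by rewrite -ltr_pdivrMr// truncnS_gt.
have := bound m; rewrite leNgt => /negP; apply.
apply: lt_le_trans Hm _.
have k2 : 0 <= k / 2 by rewrite divr_ge0// ltW.
have bm := bernoulli_ineq m k2.
have cm : 0 < c / k * mean a phi by rewrite !mulr_gt0 ?invr_gt0.
rewrite /q [X in _ <= X]mulrAC mulrCA ler_pM2l//; apply: le_trans bm.
by rewrite lerDr.
Qed.

Lemma hartley_null_eq0 f x : hartley_null a f -> f x = 0.
Proof.
move=> fo; apply/le_anti; rewrite hartley_null_le0//=.
by rewrite -oppr_le0 -mulN1r (hartley_null_le0 x (hartley_nullZ a0 (-1) fo)).
Qed.

End Complete.

(** * Multiplicities of the eigenvalues *)

Section Dim.
Context {R : realType} {T : Type}.

(** The matrix that expresses an independent family of [d] functions by [e]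
    functions has independent rows. *)
Lemma has_dim_le (V : set (T -> R)) (d e : nat) :
  has_dim V d -> has_dim V e -> (d <= e)%N.
Proof.
move=> [b [Vb fb _]] [b' [_ _ sb']].
have H i : exists c : 'I_e -> R, forall t, b i t = \sum_(j < e) c j * b' j t.
  exact/sb'/Vb.
pose M := \matrix_(i < d, j < e) (sval (cid (H i)) j).
have bM i t : b i t = \sum_(j < e) M i j * b' j t.
  rewrite (svalP (cid (H i))); apply: eq_bigr => j _.
  by rewrite mxE.
suff : row_free M by rewrite /row_free => /eqP <-; exact: rank_leq_col.
rewrite -kermx_eq0; apply/eqP/matrixP => i j; rewrite [RHS]mxE.
apply: (fb (kermx M i)) => t.
under eq_bigr => k _ do rewrite bM mulr_sumr.
rewrite exchange_big/= big1// => k _.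
under eq_bigr => l _ do rewrite mulrA.
rewrite -mulr_suml.
have /matrixP/(_ i k) := mulmx_ker M; rewrite !mxE => ->.
by rewrite mul0r.
Qed.

Lemma has_dim_uniq (V : set (T -> R)) (d e : nat) :
  has_dim V d -> has_dim V e -> d = e.
Proof.
move=> Vd Ve; apply/eqP.
by rewrite eqn_leq (has_dim_le Vd Ve) (has_dim_le Ve Vd).
Qed.

End Dim.

Section Torus.
Context {R : realType} {n : nat} (G : lattice R n).

Lemma torus_piP x y : torus_pi G x = torus_pi G y <-> lattice_set G (x - y).
Proof.
split=> [/eqmodP/asboolP//|h].
by apply/eqmodP/asboolP.
Qed.

Definition torus_repr (t : torus G) : 'cV[R]_n := repr t.

Lemma torus_reprK t : torus_pi G (torus_repr t) = t.
Proof. exact: reprK. Qed.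

End Torus.

Section Eigenspaces.
Context {R : realType} {n : nat} (G : lattice R n) (a : 'I_n -> R).
Hypothesis a0 : forall i, 0 < a i.
Hypothesis GE : forall x, lattice_set G x <-> exists z, x = lattice_vec a z.

Lemma torus_lattice_periodic (f : torus G -> R) :
  lattice_periodic a (f \o torus_pi G).
Proof.
move=> z x /=; congr f; apply/torus_piP/GE; exists z.
by rewrite addrAC subrr add0r.
Qed.

Lemma lift_repr (h : 'cV[R]_n -> R) x : lattice_periodic a h ->
  h (torus_repr (torus_pi G x)) = h x.
Proof.
move=> hp; have /torus_piP/GE[z xz] := torus_reprK (torus_pi G x).
by rewrite -[in LHS](subrK x (torus_repr _)) xz addrC hp.
Qed.

(** The projection of an eigenfunction on the Hartley functions with eigenvalue
    [mu] leaves a remainder with vanishing coefficients: those at other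
    eigenvalues vanish by integration by parts. *)
Lemma eigenspace_dim (mu : R) (s : seq {ffun 'I_n -> int}) : uniq s ->
  (forall k, (k \in s) = (eigval a k == mu)) ->
  has_dim (laplace_eigenspace G mu) (size s).
Proof.
move=> us sE; pose K (i : 'I_(size s)) := nth 0 s i.
have Kmu i : eigval a (K i) = mu by apply/eqP; rewrite -sE mem_nth.
have Kinj i j : (K i == K j) = (i == j) by rewrite nth_uniq.
have hp k : lattice_periodic a (hartley a k).
  by have [] := cperiodic_wave a0 k 1 1.
have lift k : (fun t => hartley a k (torus_repr t)) \o torus_pi G = hartley a k.
  by apply/funext => x /=; rewrite lift_repr.
have cch i : cperiodic a (hartley a (K i)) by exact: cperiodic_wave.
exists (fun i t => hartley a (K i) (torus_repr t)); split.
- move=> i; split=> [|x]; rewrite lift; first exact: smooth_wave.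
  by rewrite laplacian_wave -/(eigval a (K i)) Kmu /= lift_repr.
- move=> c c0 j.
  have :
      mean a (fun x => \sum_i c i * (hartley a (K i) x * hartley a (K j) x)) = 0.
    rewrite (_ : (fun x => _) = fun=> 0) ?mean_cst//; apply/funext => x.
    transitivity ((\sum_i c i * hartley a (K i) (torus_repr (torus_pi G x))) *
      hartley a (K j) x); last by rewrite c0 mul0r.
    by rewrite mulr_suml; apply: eq_bigr => i _; rewrite lift_repr// mulrA.
  rewrite mean_sum//; last by move=> i; apply/cperiodicZ/cperiodicM.
  under eq_bigr => i _.
    rewrite meanZ//; last exact: cperiodicM.
    rewrite mean_hartley// Kinj; over.
  rewrite (bigD1 j)//= eqxx mulr1 big1 ?addr0// => i ij.
  by rewrite (negPf ij) mulr0.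
move=> f [fs fe]; pose F := f \o torus_pi G.
have Fp : lattice_periodic a F by exact: torus_lattice_periodic.
have cF : cperiodic a F by split=> // x; have [+ _] := fs 0%N; exact.
pose c i := mean a (fun x => F x * hartley a (K i) x); exists c => t.
pose g x := F x + \sum_i - c i * hartley a (K i) x.
have cg : cperiodic a g.
  by apply: cperiodicD => //; apply: cperiodic_sum => i; exact: cperiodicZ.
suff og : hartley_null a g.
  have := hartley_null_eq0 a0 (torus_repr t) og.
  rewrite /g /F /= torus_reprK => /eqP.
  by under eq_bigr => i _ do rewrite mulNr; rewrite sumrN subr_eq0 => /eqP.
split=> // k; have ck : cperiodic a (hartley a k) by exact: cperiodic_wave.
rewrite (_ : (fun x => _) = fun x => F x * hartley a k x +
    \sum_i - c i * (hartley a (K i) x * hartley a k x)); last first.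
  apply/funext => x; rewrite /g mulrDl mulr_suml; congr (_ + _).
  by apply: eq_bigr => i _; rewrite mulrA.
rewrite meanD//; [|exact: cperiodicM|]; last first.
  by apply: cperiodic_sum => i; apply/cperiodicZ/cperiodicM.
rewrite mean_sum//; last by move=> i; apply/cperiodicZ/cperiodicM.
under eq_bigr => i _.
  rewrite meanZ//; last exact: cperiodicM.
  rewrite mean_hartley//; over.
have [kmu|kmu] := eqVneq (eigval a k) mu.
  have /(nthP 0)[j js jk] : k \in s by rewrite sE kmu.
  rewrite -jk (bigD1 (Ordinal js))//= eqxx mulr1 big1 => [|i ij].
    by rewrite addr0 /c /K/= subrr.
  rewrite -[nth 0 s j]/(K (Ordinal js)) Kinj (negPf ij) mulr0//.
rewrite (mean_eigenfunction a0 fs Fp fe kmu) add0r big1// => i _.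
by case: eqP => [kK|_]; rewrite ?mulr0//; rewrite -kK Kmu eqxx in kmu.
Qed.

Definition sqfreq : seq R := [seq (pi *+ 2 / a i) ^+ 2 | i <- enum 'I_n].

Lemma size_sqfreq : size sqfreq = n.
Proof. by rewrite size_map size_enum_ord. Qed.

Lemma nth_sqfreq (i : 'I_n) : sqfreq`_i = (pi *+ 2 / a i) ^+ 2.
Proof. by rewrite (nth_map i) ?size_enum_ord// nth_ord_enum. Qed.

Lemma sqfreq_gt0 : {in sqfreq, forall x, 0 < x}.
Proof.
move=> _ /mapP[i _ ->]; rewrite exprn_gt0// divr_gt0//.
by rewrite mulrn_wgt0// pi_gt0.
Qed.

Lemma qform_sum (b : seq R) z : size z = size b ->
  qform b z = \sum_(i < size b) b`_i * (z`_i)%:~R ^+ 2.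
Proof.
elim: b z => [|x b IH] [|k z]//=; first by rewrite big_ord0.
by move=> [sz]; rewrite big_ord_recl IH.
Qed.

Lemma qform_eigval z : size z = n ->
  qform sqfreq z = eigval a [ffun i : 'I_n => z`_i].
Proof.
move=> sz; rewrite qform_sum ?size_sqfreq//.
apply: eq_bigr => i _; rewrite nth_sqfreq /freq ffunE; ring.
Qed.

(** The list of integer solutions is an index set for the Hartley functions of
    the eigenspace. *)
Lemma eigenspace_nsols (mu : R) :
  has_dim (laplace_eigenspace G mu) (nsols sqfreq mu).
Proof.
pose toff (z : seq int) : {ffun 'I_n -> int} := [ffun i : 'I_n => z`_i].
have szs z : z \in sols sqfreq mu -> size z = n /\ eigval a (toff z) = mu.
  rewrite mem_sols; last exact: sqfreq_gt0.
  rewrite size_sqfreq => /andP[/eqP sz /eqP <-]; split=> //.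
  by rewrite qform_eigval.
rewrite /nsols -(size_map toff); apply: eigenspace_dim.
  rewrite map_inj_in_uniq ?sols_uniq// => y z /szs[sy _] /szs[sz _] /ffunP yz.
  apply: (@eq_from_nth _ 0) => [|i]; first by rewrite sy sz.
  by rewrite sy => ni; have := yz (Ordinal ni); rewrite !ffunE.
move=> k; apply/mapP/idP => [[z /szs[_ <-] ->]//|/eqP kmu].
have kE : toff [seq k i | i <- enum 'I_n] = k.
  by apply/ffunP => i; rewrite ffunE (nth_map i) ?size_enum_ord// nth_ord_enum.
exists [seq k i | i <- enum 'I_n] => //.
rewrite mem_sols; last exact: sqfreq_gt0.
have sk : size [seq k i | i <- enum 'I_n] = n by rewrite size_map size_enum_ord.
by rewrite size_sqfreq sk qform_eigval// eqxx/= -/(toff _) kE kmu.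
Qed.

End Eigenspaces.

(** * Isometries that permute the coordinates *)

(** Changing the sign of a diagonal entry is compensated by changing the sign of
    an integer coordinate. *)
Lemma rectangular_lattice_vec (R : realType) (n : nat) (G : lattice R n) :
  rectangular G -> exists2 a : 'I_n -> R, forall i, 0 < a i &
    forall x, lattice_set G x <-> exists z, x = lattice_vec a z.
Proof.
move=> [A [Au ->] /is_diag_mxP Ad].
have A0 i : A i i != 0.
  move: Au; rewrite unitmxE unitfE.
  apply: contraNneq => Aii; rewrite (expand_det_row A i) big1// => j _.
  by have [<-|ij] := eqVneq i j; rewrite ?Aii ?Ad ?mul0r.
have AE (z : 'cV[int]_n) i : (A *m map_mx intr z) i 0 = A i i * (z i 0)%:~R.
  rewrite mxE (bigD1 i)//= mxE big1 ?addr0// => j ji.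
  by rewrite Ad ?mul0r// eq_sym.
exists (fun i => `|A i i|) => [i|x]; first by rewrite normr_gt0.
split=> [[z _ <-]|[z ->]].
  exists (fun i => if 0 <= A i i then z i 0 else - z i 0).
  apply/colP => i; rewrite AE mxE.
  have [Ai|Ai] := leP 0 (A i i); first by rewrite ger0_norm.
  by rewrite ltr0_norm// rmorphN mulrNN.
exists (\col_i (if 0 <= A i i then z i else - z i)) => //.
apply/colP => i; rewrite AE !mxE.
have [Ai|Ai] := leP 0 (A i i); first by rewrite ger0_norm.
by rewrite ltr0_norm// rmorphN mulrN mulNr.
Qed.

Section Permutation.
Context {R : realType} {n : nat}.
Implicit Types (s : 'S_n) (x : 'cV[R]_n).

Lemma row_permE s x i : row_perm s x i 0 = x (s i) 0.
Proof. by rewrite mxE. Qed.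

Lemma row_perm_continuous s : continuous (row_perm s : 'cV[R]_n -> 'cV[R]_n).
Proof.
move=> x B /nbhs_ballP[e e0 eB]; apply/nbhs_ballP; exists e => //= y [_ xy].
by apply: eB; split=> // i j; rewrite !mxE; exact: xy.
Qed.

Lemma smooth_row_perm s (j : 'I_n) :
  smooth_on setT (fun x : 'cV[R]_n => row_perm s x j 0).
Proof.
have coordE : (fun x : 'cV[R]_n => row_perm s x j 0) =
    linform (fun i => (i == s j)%:R).
  apply/funext => x; rewrite row_permE /linform (bigD1 (s j))//= eqxx mul1r.
  by rewrite big1 ?addr0// => i /negPf ->; rewrite mul0r.
rewrite coordE; move: (fun i => _) => w k.
have cstC (c : R) m : Ck_on setT m (fun _ : 'cV[R]_n => c).
  elim: m c => [|m IH] c /=; first by split=> // x _; exact: cst_continuous.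
  split=> [x _|i]; first exact: cst_continuous.
  split=> [x _|]; first exact: derivable_cst.
  rewrite (_ : 'D_(basis_vec i) _ = fun=> 0); first exact: IH.
  by apply/funext => x; exact: derive_cst.
have dlin i x : is_derive x (basis_vec i) (linform w) (w i).
  apply: is_derive_line.
  rewrite (_ : (fun t => _) = cst (linform w x) + w i \*: (id : R -> R)).
    have := is_deriveD (is_derive_cst (linform w x) (0 : R) 1)
      (is_deriveZ (w i) (is_derive_id (0 : R) (1 : R))).
    by rewrite add0r [_ *: _]mulr1.
  by apply/funext => t; rewrite linform_line /= mulrC.
case: k => [|k] /=; first by split=> // x _; exact: linform_continuous.
split=> [x _|i]; first exact: linform_continuous.
split=> [x _|]; first by have [] := dlin i x.
rewrite (_ : 'D_(basis_vec i) _ = fun=> w i); first exact: cstC.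
by apply/funext => x; have [_ ->] := dlin i x.
Qed.

Lemma dot_row_perm s (u v : 'cV[R]_n) :
  dot (row_perm s u) (row_perm s v) = dot u v.
Proof.
rewrite /dot [RHS](reindex_inj (@perm_inj _ s)).
by apply: eq_bigr => i _; rewrite !row_permE.
Qed.

Lemma row_permK s x : row_perm s^-1 (row_perm s x) = x.
Proof. by apply/colP => i; rewrite !row_permE permKV. Qed.

Definition torus_perm (G L : lattice R n) s (t : torus G) : torus L :=
  torus_pi L (row_perm s (torus_repr t)).

Lemma torus_permE (G L : lattice R n) s x :
  (forall y, lattice_set G y -> lattice_set L (row_perm s y)) ->
  @torus_perm G L s (torus_pi G x) = torus_pi L (row_perm s x).
Proof.
move=> GL; apply/torus_piP; rewrite -linearB; apply: GL.
by apply/torus_piP; rewrite torus_reprK.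
Qed.

Lemma local_lift_perm (G L : lattice R n) s :
  (forall y, lattice_set G y -> lattice_set L (row_perm s y)) ->
  local_lift (@torus_perm G L s) setT (row_perm s).
Proof.
move=> GL; split; [exact: openT|exact: smooth_row_perm|].
by move=> x _; rewrite torus_permE.
Qed.

(** Both directions lift to permutations of the coordinates of [R ^ n]; these
    are linear, hence equal to their differentials, and preserve the dot
    product. *)
Lemma isometric_perm (G L : lattice R n) s :
  (forall y, lattice_set G y -> lattice_set L (row_perm s y)) ->
  (forall y, lattice_set L y -> lattice_set G (row_perm s^-1 y)) ->
  isometric G L.
Proof.
move=> GL LG; exists (@torus_perm G L s), (@torus_perm L G s^-1).
split.
- by move=> t; rewrite -[t]torus_reprK !torus_permE// row_permK.
- move=> t; rewrite -[t]torus_reprK !torus_permE//.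
  by rewrite -{1}[s]invgK row_permK.
- by move=> x; exists setT, (row_perm s) => //; exact: local_lift_perm.
- by move=> x; exists setT, (row_perm s^-1) => //; exact: local_lift_perm.
move=> x; exists setT, (row_perm s); split=> //; first exact: local_lift_perm.
by move=> u v; rewrite (diff_lin x (@row_perm_continuous s)) dot_row_perm.
Qed.

End Permutation.

Theorem theorem2p35 (R : realType) (n m : nat)
    (G : lattice R n) (L : lattice R m) :
  rectangular G -> rectangular L -> isospectral G L -> isometric G L.
Proof.
move=> /rectangular_lattice_vec[a a0 GE] /rectangular_lattice_vec[b b0 LE] GL.
have /nsols_inj : nsols (sqfreq a) =1 nsols (sqfreq b).
  move=> mu; apply: has_dim_uniq (eigenspace_nsols b0 LE mu).
  exact/GL/eigenspace_nsols.
move=> /(_ (sqfreq_gt0 a0) (sqfreq_gt0 b0)) ab.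
have nm : n = m by rewrite -(size_sqfreq a) -(size_sqfreq b) (perm_size ab).
subst m.
have sb : size (sqfreq b) == n by rewrite size_sqfreq.
have /tuple_permP[s abE] : perm_eq (sqfreq a) (Tuple sb) by [].
have abs i : a i = b (s i).
  have := nth_sqfreq a i; rewrite abE -tnth_nth tnth_mktuple.
  rewrite (tnth_nth 0)/= nth_sqfreq => /eqP.
  have pi2 : 0 < pi *+ 2 :> R by rewrite mulrn_wgt0// pi_gt0.
  rewrite eqrXn2// ?divr_ge0 ?ltW// => /eqP/(mulfI _).
  by move=> /(_ (lt0r_neq0 pi2))/invr_inj.
apply: (@isometric_perm _ _ _ _ s^-1) => y.
  move=> /GE[z ->]; apply/LE; exists (fun i => z ((s^-1)%g i)).
  by apply/colP => i; rewrite !mxE abs permKV.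
move=> /LE[z ->]; apply/GE; exists (fun i => z (s i)).
by apply/colP => i; rewrite !mxE abs invgK.
Qed.
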